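(* Let $\Omega$, $J$ and $\lambda,\mu,p,q,\alpha,\beta>0$ be as in the context, and let $(u,v)$ be a quenching solution of system (S), with quenching time $T<\infty$. (i) Assume that there is $\delta>0$ with $v(x,t)\ge\delta$ for every $(x,t)\in\overline\Omega\times[0,T)$. Then $q-\alpha<1$ and $$\min_{x\in\overline\Omega}u(x,t)\sim(T-t)^{\frac{1}{1+\alpha}}.$$ (ii) Assume that there is $\delta>0$ with $u(x,t)\ge\delta$ for every $(x,t)\in\overline\Omega\times[0,T)$. Then $p-\beta<1$ and $$\min_{x\in\overline\Omega}v(x,t)\sim(T-t)^{\frac{1}{1+\beta}}.$$
   Context: Setting. $\Omega\subset\mathbb{R}^N$ is an open bounded connected smooth domain. The kernel $J:\mathbb{R}^N\to\mathbb{R}$ is a non-negative $C^1$ function, radially symmetric, decreasing (in the radial variable), with $\int_{\mathbb{R}^N}J(s)\,ds=1$. The parameters satisfy $\lambda,\mu,p,q,\alpha,\beta>0$. System (S) is, for $x\in\overline\Omega$ and $t\in[0,T)$, $$u_t(x,t)=\int_\Omega J(x-y)u(y,t)\,dy+\int_{\mathbb{R}^N\setminus\Omega}J(x-y)\,dy-u(x,t)-\lambda v^{-p}(x,t)u^{-\alpha}(x,t),$$ $$v_t(x,t)=\int_\Omega J(x-y)v(y,t)\,dy+\int_{\mathbb{R}^N\setminus\Omega}J(x-y)\,dy-v(x,t)-\mu u^{-q}(x,t)v^{-\beta}(x,t),$$ with $u(x,0)=u_0(x)>0$, $v(x,0)=v_0(x)>0$, where $u_0,v_0\in\mathcal{C}(\overline\Omega)$.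 A solution is a pair $(u,v)\in\mathcal{C}^\infty([0,T),\mathcal{C}(\overline\Omega)\times\mathcal{C}(\overline\Omega))$ of positive functions satisfying these equations pointwise in $\overline\Omega\times[0,T)$; $T\in(0,\infty]$ denotes its maximal existence time. It presents quenching in finite time $T$ (is a quenching solution) if $T<\infty$ and $\liminf_{t\nearrow T}\min\{\min_{\overline\Omega}u(\cdot,t),\min_{\overline\Omega}v(\cdot,t)\}=0$. Notation: $f(t)\sim g(t)$ means that there exist $C_1,C_2>0$ and $t_0\in[0,T)$ such that $C_1f(t)\le g(t)\le C_2f(t)$ for $t\in[t_0,T)$. *)

(* Defs.v *)
From HB Require Import structures.
From mathcomp Require Import all_boot all_order all_algebra.
From mathcomp Require Import all_classical all_reals all_analysis.
Import Order.TTheory GRing.Theory Num.Theory.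
Import numFieldNormedType.Exports.

Set Implicit Arguments.
Unset Strict Implicit.
Unset Printing Implicit Defensive.

Local Open Scope classical_set_scope.
Local Open Scope ring_scope.

Fact rV_display : measure_display. Proof. exact: default_measure_display. Qed.

(* The sigma-algebra on R^n is generated by the coordinates: it is the Borel one. *)
Section measurable_rV.
Context (R : realType) (n : nat).

Let coord (i : 'I_n) (x : 'rV[R]_n) : R := x 0 i.

Let rV_set0 : g_sigma_preimage coord set0.
Proof. exact: sigma_algebra0. Qed.

Let rV_setC A : g_sigma_preimage coord A -> g_sigma_preimage coord (~` A).
Proof. exact: sigma_algebraC. Qed.

Let rV_bigcup (F : (set 'rV[R]_n)^nat) :
  (forall i, g_sigma_preimage coord (F i)) ->
  g_sigma_preimage coord (\bigcup_i (F i)).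
Proof. exact: sigma_algebra_bigcup. Qed.

HB.instance Definition _ :=
  @isMeasurable.Build rV_display 'rV[R]_n
    (g_sigma_preimage coord) rV_set0 rV_setC rV_bigcup.

Lemma measurable_coord (i : 'I_n) :
  measurable_fun [set: 'rV[R]_n] (fun x : 'rV[R]_n => x 0 i).
Proof.
move=> _ Y mY; rewrite setTI; apply: sub_sigma_algebra => /=.
rewrite -bigcup_seq/=; exists i => /=; first by rewrite mem_index_enum.
by exists Y => //; rewrite setTI.
Qed.

Lemma measurable_fun_rV d (T : measurableType d) (f : T -> 'rV[R]_n) :
  (forall i, measurable_fun [set: T] (fun x => f x 0 i)) ->
  measurable_fun [set: T] f.
Proof.
move=> mf.
have sub : g_sigma_preimage (fun i x => coord i (f x)) `<=` @measurable d T.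
  apply: smallest_sub; first exact: sigma_algebra_measurable.
  rewrite -bigcup_seq; apply: bigcup_sub => i _ A [B mB <-].
  exact: mf.
move=> _ A mA; apply: sub.
by rewrite (g_sigma_preimage_comp coord f); exists A.
Qed.

End measurable_rV.

(* Lebesgue measure on R^(1+n) is the image of (Lebesgue on R) x (Lebesgue on R^n)
   under (a, x) |-> row_mx a x. *)
Section lebesgue_step.
Context (R : realType) (n : nat).

Definition rV_cons (p : measurableTypeR R * 'rV[R]_n) : 'rV[R]_n.+1 :=
  row_mx ((p.1 : R)%:M : 'rV[R]_1) p.2.

Let rV_uncons (x : 'rV[R]_n.+1) : measurableTypeR R * 'rV[R]_n :=
  (x 0 ord0, \row_i x 0 (lift ord0 i)).

Lemma rV_cons0 p : rV_cons p 0 ord0 = p.1.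
Proof.
have e : ord0 = lshift n ord0 :> 'I_(1 + n) by exact: val_inj.
apply: etrans (congr1 (row_mx ((p.1 : R)%:M : 'rV[R]_1) p.2 0) e) _.
by rewrite row_mxEl mxE mulr1n.
Qed.

Lemma rV_consS p i : rV_cons p 0 (lift ord0 i) = p.2 0 i.
Proof.
have e : lift ord0 i = rshift 1 i :> 'I_(1 + n) by exact: val_inj.
apply: etrans (congr1 (row_mx ((p.1 : R)%:M : 'rV[R]_1) p.2 0) e) _.
by rewrite row_mxEr.
Qed.

Let rV_consK : cancel rV_cons rV_uncons.
Proof.
move=> [a x]; rewrite /rV_uncons rV_cons0; congr pair.
by apply/rowP => i; rewrite mxE rV_consS.
Qed.

Lemma measurable_rV_cons :
  measurable_fun [set: measurableTypeR R * 'rV[R]_n] rV_cons.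
Proof.
apply: measurable_fun_rV => i.
have [->|] := eqVneq i ord0.
  under eq_fun do rewrite rV_cons0.
  exact: measurable_fst.
rewrite eq_sym => /unlift_some[j -> _].
under eq_fun do rewrite rV_consS.
rewrite (_ : (fun _ => _) = (fun x : 'rV[R]_n => x 0 j) \o snd)//.
by apply: measurableT_comp; [exact: measurable_coord|exact: measurable_snd].
Qed.

Let measurable_rV_uncons : measurable_fun [set: 'rV[R]_n.+1] rV_uncons.
Proof.
apply/measurable_fun_pairP; split; first exact: measurable_coord.
apply: measurable_fun_rV => i.
rewrite (_ : (fun _ => _) = (fun x : 'rV[R]_n.+1 => x 0 (lift ord0 i))).
  exact: measurable_coord.
by apply/funext => x /=; rewrite mxE.
Qed.

Variable m : {sigma_finite_measure set 'rV[R]_n -> \bar R}.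

Definition lebesgue_step : set 'rV[R]_n.+1 -> \bar R :=
  pushforward (@lebesgue_measure R \x m)%E rV_cons.

Let lebesgue_step0 : lebesgue_step set0 = 0%E.
Proof. by rewrite /lebesgue_step /pushforward preimage_set0 measure0. Qed.

Let lebesgue_step_ge0 A : (0 <= lebesgue_step A)%E.
Proof. by rewrite /lebesgue_step /pushforward measure_ge0. Qed.

Let lebesgue_step_sigma_additive : semi_sigma_additive lebesgue_step.
Proof.
move=> F mF tF mUF; rewrite /lebesgue_step /pushforward preimage_bigcup.
have mpre A : measurable A -> measurable (rV_cons @^-1` A).
  by move=> mA; rewrite -[X in measurable X]setTI; exact: measurable_rV_cons.
apply: measure_semi_sigma_additive.
- by move=> k; exact: mpre.
- apply/trivIsetP => /= i j _ _ ij; rewrite -preimage_setI.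
  by move/trivIsetP : tF => /(_ _ _ _ _ ij) ->//; rewrite preimage_set0.
- by rewrite -preimage_bigcup; exact: mpre.
Qed.

HB.instance Definition _ := isMeasure.Build _ _ _ lebesgue_step
  lebesgue_step0 lebesgue_step_ge0 lebesgue_step_sigma_additive.

Let lebesgue_step_sigma_finite : sigma_finite setT lebesgue_step.
Proof.
have /sigma_finiteP[F [TF ndF Foo]] := sigma_finiteT (@lebesgue_measure R).
have /sigma_finiteP[G [TG ndG Goo]] := sigma_finiteT m.
exists (fun k => rV_uncons @^-1` (F k `*` G k)).
  rewrite -preimage_bigcup; apply/esym/seteqP; split => // x _ /=.
  have [i _ Fi] : (\bigcup_k F k) (rV_uncons x).1 by rewrite -TF.
  have [j _ Gj] : (\bigcup_k G k) (rV_uncons x).2 by rewrite -TG.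
  exists (maxn i j) => //; split.
    by move: Fi; exact/subsetPset/ndF/leq_maxl.
  by move: Gj; exact/subsetPset/ndG/leq_maxr.
move=> k; have [mF Fk] := Foo k; have [mG Gk] := Goo k; split.
  rewrite -[X in measurable X]setTI; apply: measurable_rV_uncons => //.
  exact: measurableX.
rewrite /lebesgue_step /pushforward -comp_preimage.
rewrite (_ : rV_uncons \o rV_cons = id); last first.
  by apply/funext => p /=; rewrite rV_consK.
by rewrite preimage_id product_measure1E// lte_mul_pinfty// ge0_fin_numE.
Qed.

HB.instance Definition _ := Measure_isSigmaFinite.Build _ _ _ lebesgue_step
  lebesgue_step_sigma_finite.

End lebesgue_step.

(* For n = 0 the space is a point, of mass 1. *)
Fixpoint lebesgue_rV (R : realType) (n : nat) :
    {sigma_finite_measure set 'rV[R]_n -> \bar R} :=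
  match n with
  | 0 => \d_(0 : 'rV[R]_0)
  | n'.+1 => lebesgue_step (lebesgue_rV R n')
  end.

Definition euclid_norm (R : realType) (N : nat) (x : 'rV[R]_N) : R :=
  Num.sqrt (\sum_i x 0 i ^+ 2).

Fixpoint Ck (R : realType) (N k : nat) (f : 'rV[R]_N -> R) : Prop :=
  match k with
  | 0 => continuous f
  | k'.+1 => (forall x, differentiable f x) /\
             (forall i : 'I_N, Ck k' ('D_(delta_mx 0 i) f))
  end.

(* Near each boundary point Omega is a sublevel set {rho < 0} of a C^oo function
   with non-vanishing gradient; in particular Omega lies on one side only of its
   boundary {rho = 0}. *)
Definition smooth_boundary (R : realType) (N : nat) (Omega : set 'rV[R]_N) : Prop :=
  forall z, (closure Omega `\` interior Omega) z ->
    exists rho : 'rV[R]_N -> R,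
      [/\ forall k, Ck k rho,
          exists i : 'I_N, 'D_(delta_mx 0 i) rho z != 0
        & \forall x \near z, Omega x <-> rho x < 0].

Definition smooth_bounded_domain (R : realType) (N : nat)
    (Omega : set 'rV[R]_N) : Prop :=
  [/\ Omega !=set0, open Omega, bounded_set Omega, connected Omega
    & smooth_boundary Omega].

Record dispersal_kernel (R : realType) (N : nat) (J : 'rV[R]_N -> R) : Prop := DispersalKernel {
  kernel_ge0 : forall x, 0 <= J x;
  kernel_C1 : Ck 1 J;
  kernel_radial : forall x y, euclid_norm x = euclid_norm y -> J x = J y;
  kernel_decreasing : forall x y, euclid_norm x <= euclid_norm y -> J y <= J x;
  kernel_mass1 : (\int[lebesgue_rV R N]_s (J s)%:E = 1)%E
}.

(* w : R -> 'rV_N -> R is seen as the curve t |-> w t defined for t in [0, T[.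
   The derivatives are relative to [0, T[, hence one-sided at t = 0. *)
Definition diff_quotient (R : realType) (N : nat) (w : R -> 'rV[R]_N -> R)
    (t s : R) : 'rV[R]_N -> R :=
  fun x => (w s x - w t x) / (s - t).

(* w is a C^oo curve in the Banach space C(K) with the sup norm; d k is its k-th
   derivative. *)
Definition smooth_curve (R : realType) (N : nat) (K : set 'rV[R]_N) (T : R)
    (w : R -> 'rV[R]_N -> R) : Prop :=
  exists2 d : nat -> R -> 'rV[R]_N -> R, d 0%N = w &
    forall (k : nat) (t : R), 0 <= t < T ->
      {within K, continuous (d k t)} /\
      {uniform K, diff_quotient (d k) t s @[s --> within `[0, T[ t^'] --> d k.+1 t}.

Definition nonlocal_diffusion (R : realType) (N : nat) (Omega : set 'rV[R]_N)
    (J w : 'rV[R]_N -> R) (x : 'rV[R]_N) : R :=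
  \int[lebesgue_rV R N]_(y in Omega) (J (x - y) * w y) +
  \int[lebesgue_rV R N]_(y in ~` Omega) J (x - y) - w x.

Definition solves_equation (R : realType) (N : nat) (Omega : set 'rV[R]_N)
    (J : 'rV[R]_N -> R) (lambda p alpha T : R) (u v : R -> 'rV[R]_N -> R) : Prop :=
  forall t x, 0 <= t < T -> closure Omega x ->
    diff_quotient u t s x @[s --> within `[0, T[ t^'] -->
      nonlocal_diffusion Omega J (u t) x
        - lambda * v t x `^ (- p) * u t x `^ (- alpha).

Record initial_datum (R : realType) (N : nat) (Omega : set 'rV[R]_N)
    (w0 : 'rV[R]_N -> R) : Prop := InitialDatum {
  initial_continuous : {within closure Omega, continuous w0};
  initial_gt0 : forall x, closure Omega x -> 0 < w0 x
}.

(* u t x stands for u(x, t). *)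
Record solution (R : realType) (N : nat) (Omega : set 'rV[R]_N)
    (J : 'rV[R]_N -> R) (lambda mu p q alpha beta : R) (u0 v0 : 'rV[R]_N -> R)
    (T : R) (u v : R -> 'rV[R]_N -> R) : Prop := Solution {
  solution_smooth_u : smooth_curve (closure Omega) T u;
  solution_smooth_v : smooth_curve (closure Omega) T v;
  solution_gt0_u : forall t x, 0 <= t < T -> closure Omega x -> 0 < u t x;
  solution_gt0_v : forall t x, 0 <= t < T -> closure Omega x -> 0 < v t x;
  solution_eq_u : solves_equation Omega J lambda p alpha T u v;
  solution_eq_v : solves_equation Omega J mu q beta T v u;
  solution_init_u : forall x, closure Omega x -> u 0 x = u0 x;
  solution_init_v : forall x, closure Omega x -> v 0 x = v0 x
}.

Definition extends (R : realType) (N : nat) (Omega : set 'rV[R]_N) (T : R)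
    (w w' : R -> 'rV[R]_N -> R) : Prop :=
  forall t x, 0 <= t < T -> closure Omega x -> w' t x = w t x.

Definition maximal_solution (R : realType) (N : nat) (Omega : set 'rV[R]_N)
    (J : 'rV[R]_N -> R) (lambda mu p q alpha beta : R) (u0 v0 : 'rV[R]_N -> R)
    (T : R) (u v : R -> 'rV[R]_N -> R) : Prop :=
  solution Omega J lambda mu p q alpha beta u0 v0 T u v /\
  forall T' u' v', T < T' ->
    extends Omega T u u' -> extends Omega T v v' ->
    ~ solution Omega J lambda mu p q alpha beta u0 v0 T' u' v'.

(* The infimum over the compact set closure Omega is attained when w is
   continuous there, which is the only case used. *)
Definition min_closure (R : realType) (N : nat) (Omega : set 'rV[R]_N)
    (w : 'rV[R]_N -> R) : R :=
  inf (w @` closure Omega).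

Definition quenching_solution (R : realType) (N : nat) (Omega : set 'rV[R]_N)
    (J : 'rV[R]_N -> R) (lambda mu p q alpha beta : R) (u0 v0 : 'rV[R]_N -> R)
    (T : R) (u v : R -> 'rV[R]_N -> R) : Prop :=
  maximal_solution Omega J lambda mu p q alpha beta u0 v0 T u v /\
  limf_einf (fun t => (Num.min (min_closure Omega (u t))
                               (min_closure Omega (v t)))%:E) T^'- = 0%E.

Definition same_rate (R : realType) (T : R) (f g : R -> R) : Prop :=
  exists C1 C2 t0 : R, [/\ 0 < C1, 0 < C2, 0 <= t0 < T &
    forall t, t0 <= t < T -> C1 * f t <= g t <= C2 * f t].

(* Main.v *)
Require Import Defs.
From mathcomp Require Import all_boot all_order all_algebra.
From mathcomp Require Import all_classical all_reals all_analysis.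
From mathcomp Require Import ring lra.
Import Order.TTheory GRing.Theory Num.Theory.
Import numFieldNormedType.Exports.

Local Open Scope classical_set_scope.
Local Open Scope ring_scope.

Set Implicit Arguments.
Unset Strict Implicit.
Unset Printing Implicit Defensive.

(* On a finite time interval u and v stay below some M: the nonlocal term is
   affine in the supremum, so they can be compared with an exponential. If v
   >= delta, then at each point x the function E = u(x, .)^(1+alpha) obeys -C
   <= E' <= -c1 + L E with constants independent of x. The upper bound on E'
   and E > 0 up to time T give E(t) >= c (T - t); the lower bound gives E(t)
   <= E(s) + C (s - t), where s and x can be chosen so that E(s) is as small
   as desired, because u quenches. If moreover q >= 1 + alpha, then v_t <= M -
   c / (E(s) + C (s - t)) at that same point x, and integrating this up to s
   makes v drop by a multiple of |ln E(s)|, which is impossible for delta <= v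
   <= M. Everything is done at a fixed x, so neither the differentiability of
   the minimum nor a limiting quenching point is needed. *)

(** * Derivatives of real functions and mean value inequalities *)

Lemma is_derive_addZ (R : realType) (f : R -> R) (df C t : R) :
  is_derive t 1 f df -> is_derive t 1 (fun r => f r + C * r) (df + C).
Proof.
move=> fd; have dl : is_derive t (1:R) (fun r : R => C * r) C.
  by have := is_deriveZ C (is_derive_id t (1:R)); rewrite /GRing.scale/= mulr1.
exact: (is_deriveD fd dl).
Qed.

Lemma is_derive_expRZ (R : realType) (L t : R) :
  is_derive t 1 (fun r => expR (L * r)) (expR (L * t) * L).
Proof.
have dl : is_derive t (1:R) ( *%R L) L.
  by have := is_deriveZ L (is_derive_id t (1:R)); rewrite /GRing.scale/= mulr1.
exact: (is_derive1_comp (is_derive_expR _) dl).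
Qed.

Lemma is_deriveM_real (R : realType) (f g : R -> R) (df dg t : R) :
  is_derive t 1 f df -> is_derive t 1 g dg ->
  is_derive t 1 (fun r => f r * g r) (f t * dg + g t * df).
Proof. move=> fd gd; exact: (is_deriveM fd gd). Qed.

Lemma is_derive_le (R : realType) (f df : R -> R) (a b C : R) :
  a <= b -> {within `[a, b], continuous f} ->
  (forall t, a < t < b -> is_derive t 1 f (df t)) ->
  (forall t, a < t < b -> df t <= C) -> f b <= f a + C * (b - a).
Proof.
move=> ab fc fdf dfC.
have gd t : a < t < b -> is_derive t 1 (fun r => f r + - C * r) (df t - C).
  by move=> /fdf /is_derive_addZ; apply.
suff : f b + - C * b <= f a + - C * a by lra.
apply: (@ler0_derive1_nincr R (fun r => f r + - C * r) a b) => //.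
- by move=> t; rewrite in_itv/= => /gd[].
- move=> t; rewrite in_itv/= => abt.
  by have [_ dgE] := gd _ abt; rewrite derive1E dgE subr_le0 dfC.
- move=> t; apply: continuousD; first exact: fc.
  apply: (@continuous_subspaceT _ _ `[a, b]%classic ( *%R (- C))).
  exact: mulrl_continuous.
Qed.

Lemma is_derive_le_cc (R : realType) (f df : R -> R) (a b C : R) :
  a <= b -> (forall t, a <= t <= b -> is_derive t 1 f (df t)) ->
  (forall t, a <= t <= b -> df t <= C) -> f b <= f a + C * (b - a).
Proof.
move=> ab fdf dfC; apply: (@is_derive_le R f df) => //.
- by apply: derivable_within_continuous => t; rewrite in_itv/= => /fdf[].
- by move=> t /andP[/ltW at0 /ltW tb]; apply: fdf; rewrite at0.
- by move=> t /andP[/ltW at0 /ltW tb]; apply: dfC; rewrite at0.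
Qed.

Lemma is_derive_ge_cc (R : realType) (f df : R -> R) (a b C : R) :
  a <= b -> (forall t, a <= t <= b -> is_derive t 1 f (df t)) ->
  (forall t, a <= t <= b -> C <= df t) -> f a + C * (b - a) <= f b.
Proof.
move=> ab fdf dfC.
have : - f b <= - f a + - C * (b - a).
  apply: (@is_derive_le_cc R (fun r => - f r) (fun r => - df r)) => // t abt.
    exact: (is_deriveN (fdf _ abt)).
  by rewrite lerN2 dfC.
lra.
Qed.

(** * Differential inequalities for the power 1 + alpha of a function with singular absorption *)

Lemma is_derive_powR_ode (R : realType) (alpha D h t : R) (f : R -> R) :
  0 < f t -> is_derive t 1 f (D - h * f t `^ (- alpha)) ->
  is_derive t 1 (fun s => f s `^ (1 + alpha))
    ((1 + alpha) * (D * f t `^ alpha - h)).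
Proof.
move=> f0 fd; have := is_derive1_comp (is_derive1_powR (1 + alpha) f0) fd.
move/is_derive_eq; apply.
(* The chain rule brings a factor (1 + alpha) f^alpha, which cancels the singular f^(-alpha) and
   leaves the bare coefficient [h]. *)
rewrite (_ : 1 + alpha - 1 = alpha); last by ring.
rewrite -mulrA mulrBr (mulrC D) (mulrCA _ h) -powRD.
  by rewrite subrr powRr0 mulr1.
by rewrite (gt_eqF f0) implybT.
Qed.

(** If y^alpha > eta, then y >= eta^(1/alpha), so y^alpha = y^(1+alpha) / y is at most the second
    term. This trades the sublinear source f^alpha for a small constant plus a term linear in
    f^(1+alpha). *)
Lemma powR_young (R : realType) (alpha eta y : R) :
  0 < alpha -> 0 < eta -> 0 < y ->
  y `^ alpha <= eta + eta `^ (- alpha^-1) * y `^ (1 + alpha).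
Proof.
move=> alpha0 eta0 y0.
have [yle|/ltW ley] := leP (y `^ alpha) eta.
  by rewrite ler_wpDr// mulr_ge0// powR_ge0.
rewrite ler_wpDl ?(ltW eta0)//.
have eta1 : 0 < eta `^ alpha^-1 by rewrite powR_gt0.
have {}ley : eta `^ alpha^-1 <= y.
  rewrite -[leRHS](@powRr1 _ y (ltW y0)) -(@mulfV _ alpha) ?gt_eqF// powRrM.
  by apply: ge0_ler_powR; rewrite ?nnegrE ?powR_ge0 ?invr_ge0// ltW.
rewrite powRN powRD ?(gt_eqF y0) ?implybT// powRr1 ?(ltW y0)//.
rewrite mulrA ler_peMl ?powR_ge0//.
by rewrite ler_pdivlMl// mulr1.
Qed.

(** Since D f^alpha >= - M^(1+alpha) and h <= b, the derivative of f^(1+alpha) is bounded below. The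
    bound runs backwards in time: a small value at [s] forces small values shortly before. *)
Lemma quenching_ode_le (R : realType) (alpha M b t s : R) (f D h : R -> R) :
  0 < alpha -> 0 < M -> t <= s ->
  (forall r, t <= r <= s -> 0 < f r <= M) ->
  (forall r, t <= r <= s ->
    is_derive r 1 f (D r - h r * f r `^ (- alpha))) ->
  (forall r, t <= r <= s -> - M <= D r) ->
  (forall r, t <= r <= s -> h r <= b) ->
  f t `^ (1 + alpha) <=
    f s `^ (1 + alpha) + (1 + alpha) * (M `^ (1 + alpha) + b) * (s - t).
Proof.
move=> alpha0 M0 ts fM fd DM hb.
set C := _ * (_ + b).
suff : f t `^ (1 + alpha) + - C * (s - t) <= f s `^ (1 + alpha) by lra.
apply: (@is_derive_ge_cc R (fun r => f r `^ (1 + alpha))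
  (fun r => ((1 + alpha) * (D r * f r `^ alpha - h r)))) => [//|r tr|r tr];
  have /andP[f0 fM'] := fM _ tr.
  exact: (@is_derive_powR_ode R alpha (D r) (h r) r f f0 (fd _ tr)).
rewrite /C -mulrN ler_pM2l ?addr_gt0// opprD lerB ?hb//.
apply: (@le_trans _ _ (- M * f r `^ alpha)); last first.
  by rewrite ler_wpM2r ?powR_ge0 ?DM.
rewrite mulNr lerN2 powRD ?(gt_eqF M0) ?implybT// powRr1 ?(ltW M0)//.
by rewrite ler_pM2l//; apply: ge0_ler_powR => //; rewrite ?nnegrE ltW.
Qed.

(** With E = f^(1+alpha) one has E' <= -(1 + alpha) a/2 + L E, so exp(-L t) E decreases at least at
    rate c while staying nonnegative. The constant [c] is chosen before [f], [D] and [h], so that it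
    is uniform over the points of the domain. *)
Lemma quenching_ode_ge (R : realType) (alpha T M a : R) :
  0 < alpha -> 0 < T -> 0 < M -> 0 < a ->
  exists2 c, 0 < c & forall f D h : R -> R,
    (forall t, 0 < t < T -> 0 < f t) ->
    (forall t, 0 < t < T ->
      is_derive t 1 f (D t - h t * f t `^ (- alpha))) ->
    (forall t, 0 < t < T -> D t <= M) ->
    (forall t, 0 < t < T -> a <= h t) ->
    forall t, 0 < t < T -> c * (T - t) <= f t `^ (1 + alpha).
Proof.
move=> alpha_gt0 T_gt0 M_gt0 a_gt0.
(* This [eta] gives M eta = a/2, so that half of the absorption survives; [L] is the resulting
   linear growth rate, and exp(-L T) in [c] is a lower bound of the integrating factor on [0, T]. *)
pose eta := a / (2 * M).
have eta0 : 0 < eta by rewrite divr_gt0// mulr_gt0.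
pose L := (1 + alpha) * M * eta `^ (- alpha^-1).
have L0 : 0 <= L by rewrite !mulr_ge0 ?powR_ge0 ?addr_ge0 ?ltW.
pose c := (1 + alpha) * (a / 2) * expR (- L * T).
have a2 : 0 < (1 + alpha) * (a / 2) by rewrite mulr_gt0 ?addr_gt0 ?divr_gt0.
have c0 : 0 < c by rewrite mulr_gt0 ?expR_gt0.
exists c => // f D h f_gt0 f_ode DM ha t /andP[t0 tT].
set E := fun r => f r `^ (1 + alpha).
(* Nothing is known at time T, so the estimate is proved up to each s < T. If the limit s -> T
   failed, the midpoint of t + E t / c and T would be a contradicting choice of [s]. *)
suff step s : t <= s -> s < T -> c * (s - t) <= E t.
  rewrite leNgt; apply/negP => Elt.
  have lt1 : E t / c < T - t by rewrite ltr_pdivrMr// mulrC.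
  have E0 : 0 <= E t / c by rewrite divr_ge0 ?powR_ge0 ?ltW.
  have /step : t <= (t + E t / c + T) / 2 by lra.
  have /[swap]/[apply] : (t + E t / c + T) / 2 < T by lra.
  rewrite mulrC -ler_pdivlMr//; lra.
move=> ts sT.
have tsT r : t <= r <= s -> 0 < r < T.
  by move=> /andP[tr rs]; rewrite (lt_le_trans t0 tr) (le_lt_trans rs sT).
have : expR (- L * s) * E s <= expR (- L * t) * E t + - c * (s - t).
  apply: (@is_derive_le_cc R (fun r => expR (- L * r) * E r)
     (fun r => expR (- L * r) * ((1 + alpha) * (D r * f r `^ alpha - h r))
        + E r * (expR (- L * r) * - L))) => [//|r /tsT rT|r /tsT rT].
    apply: is_deriveM_real; first exact: is_derive_expRZ.
    exact: (@is_derive_powR_ode R alpha (D r) (h r) r f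
      (f_gt0 _ rT) (f_ode _ rT)).
  have f0 := f_gt0 _ rT.
  have e0 := expR_gt0 (- L * r).
  have ee : expR (- L * T) <= expR (- L * r).
    by rewrite ler_expR !mulNr lerN2 ler_wpM2l// ltW//; case/andP: rT.
  have key : (1 + alpha) * (D r * f r `^ alpha - h r) <=
      - ((1 + alpha) * (a / 2)) + L * E r.
    have -> : - ((1 + alpha) * (a / 2)) + L * E r
      = (1 + alpha) * (M * (eta + eta `^ (- alpha^-1) * E r) - a).
      by rewrite /L /eta; field; rewrite gt_eqF.
    rewrite ler_pM2l ?addr_gt0// lerB ?ha//.
    apply: (@le_trans _ _ (M * f r `^ alpha)).
      by rewrite ler_wpM2r ?powR_ge0 ?DM.
    by rewrite ler_pM2l// powR_young.
  rewrite (mulrCA (E r)) -mulrDr.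
  apply: (@le_trans _ _ (expR (- L * r) * - ((1 + alpha) * (a / 2)))).
    by rewrite ler_pM2l//; lra.
  by rewrite /c mulrN lerN2 mulrC ler_pM2r.
have : 0 <= expR (- L * s) * E s by rewrite mulr_ge0 ?expR_ge0 ?powR_ge0.
have : expR (- L * t) * E t <= E t.
  rewrite ler_piMl ?powR_ge0//.
  by rewrite -expR0 ler_expR mulNr oppr_le0 mulr_ge0// ltW.
lra.
Qed.

(** The function -(c/C) ln(eps + C (s - r)) is a primitive in r of c / (eps + C (s - r)); adding it
    to [g] leaves a derivative at most K. The resulting drop of [g] is unbounded as eps tends to
    0. *)
Lemma is_derive_le_log (R : realType) (g dg : R -> R) (K c C eps t s : R) :
  0 < C -> 0 < eps -> t <= s ->
  (forall r, t <= r <= s -> is_derive r 1 g (dg r)) ->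
  (forall r, t <= r <= s -> dg r <= K - c / (eps + C * (s - r))) ->
  g s <= g t + K * (s - t) - c / C * (ln (eps + C * (s - t)) - ln eps).
Proof.
move=> C0 eps0 ts gd dgK.
pose l (r : R) : R := eps + C * s + - C * r.
have lE (r : R) : l r = eps + C * (s - r) by rewrite /l; ring.
have ld (r : R) : is_derive r 1 l (0 + - C).
  by apply: is_derive_addZ; exact: is_derive_cst.
have l0 (r : R) : t <= r <= s -> 0 < l r.
  by move=> /andP[_ rs]; rewrite lE ltr_pwDl// mulr_ge0 ?subr_ge0// ltW.
have lnd (r : R) : t <= r <= s ->
    is_derive r 1 (fun r : R => - (c / C) * ln (l r))
    (- (c / C) * ((l r)^-1 * (0 + - C))).
  move=> rts; have := is_derive1_comp (is_derive1_ln (l0 _ rts)) (ld r).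
  by move/(is_deriveZ (- (c / C))).
have := @is_derive_le_cc R (fun r => g r + - (c / C) * ln (l r))
  (fun r => dg r + - (c / C) * ((l r)^-1 * (0 + - C))) t s K ts.
have -> : l s = eps by rewrite /l; ring.
rewrite lE => H; suff : g s + - (c / C) * ln eps <=
   g t + - (c / C) * ln (eps + C * (s - t)) + K * (s - t) by lra.
apply: H => r rts; first exact: (is_deriveD (gd _ rts) (lnd _ rts)).
have -> : - (c / C) * ((l r)^-1 * (0 + - C)) = c / l r.
  by field; rewrite !gt_eqF// l0.
by rewrite lE; have := dgK _ rts; lra.
Qed.

(** * Inverting and comparing real powers *)

Lemma powR_le_root (R : realType) (a x y : R) : 0 < a -> 0 <= x ->
  x `^ a <= y -> x <= y `^ a^-1.
Proof.
move=> a0 x0 xy.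
rewrite -[leLHS](@powRr1 _ x x0) -(@mulfV _ a) ?gt_eqF// powRrM.
apply: ge0_ler_powR; rewrite ?nnegrE ?powR_ge0 ?invr_ge0 ?(ltW a0)//.
by rewrite (le_trans _ xy)// powR_ge0.
Qed.

Lemma root_le_powR (R : realType) (a x y : R) : 0 < a -> 0 <= x -> 0 <= y ->
  y <= x `^ a -> y `^ a^-1 <= x.
Proof.
move=> a0 x0 y0 xy.
rewrite -[leRHS](@powRr1 _ x x0) -(@mulfV _ a) ?gt_eqF// powRrM.
by apply: ge0_ler_powR; rewrite ?nnegrE ?powR_ge0 ?invr_ge0 ?(ltW a0).
Qed.

Lemma powRN_le (R : realType) (x y r : R) :
  0 < x -> x <= y -> 0 <= r -> y `^ (- r) <= x `^ (- r).
Proof.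
move=> x0 xy r0; have y0 := lt_le_trans x0 xy.
rewrite !powRN lef_pV2 ?posrE ?powR_gt0//.
by apply: ge0_ler_powR => //; rewrite nnegrE ltW.
Qed.

(** * Rate and exponent condition when only u quenches, for a family of scalar equations indexed by
    a set *)

Section one_component_quenching.
Variables (R : realType) (X : Type) (K : set X).
Variables (lambda mu p q alpha beta T M delta : R).
(** [Du] and [Dv] stand for the nonlocal diffusion of u and v, treated as bounded sources; each
    point x then carries a pair of ordinary differential equations. *)
Variables (u v Du Dv : R -> X -> R).
Hypotheses (lambda_gt0 : 0 < lambda) (mu_gt0 : 0 < mu).
Hypotheses (p_gt0 : 0 < p) (alpha_gt0 : 0 < alpha) (beta_gt0 : 0 < beta).
Hypotheses (T_gt0 : 0 < T) (M_gt0 : 0 < M) (delta_gt0 : 0 < delta).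
Hypothesis K_neq0 : K !=set0.
Hypothesis u_bnd : forall t x, 0 < t < T -> K x -> 0 < u t x <= M.
Hypothesis v_bnd : forall t x, 0 < t < T -> K x -> delta <= v t x <= M.
Hypothesis Du_bnd : forall t x, 0 < t < T -> K x -> - M <= Du t x <= M.
Hypothesis Dv_bnd : forall t x, 0 < t < T -> K x -> Dv t x <= M.
Hypothesis u_ode : forall t x, 0 < t < T -> K x ->
  is_derive t 1 (u^~ x)
    (Du t x - lambda * v t x `^ (- p) * u t x `^ (- alpha)).
Hypothesis v_ode : forall t x, 0 < t < T -> K x ->
  is_derive t 1 (v^~ x)
    (Dv t x - mu * u t x `^ (- q) * v t x `^ (- beta)).
Hypothesis u_quench : forall eps t, 0 < eps -> t < T ->
  exists s x, [/\ t < s, s < T, K x & u s x < eps].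

Let alpha1_gt0 : 0 < 1 + alpha. Proof. by rewrite addr_gt0. Qed.

(** From v >= delta the absorption coefficient lambda v^(-p) is at most lambda delta^(-p), whatever
    the point. *)
Let u_upper : exists2 C, 0 < C &
  forall t s x, 0 < t -> t <= s -> s < T -> K x ->
  u t x `^ (1 + alpha) <= u s x `^ (1 + alpha) + C * (s - t).
Proof.
exists ((1 + alpha) * (M `^ (1 + alpha) + lambda * delta `^ (- p))).
  by rewrite mulr_gt0// addr_gt0 ?mulr_gt0 ?powR_gt0.
move=> t s x t0 ts sT Kx.
have tsT r : t <= r <= s -> 0 < r < T.
  by move=> /andP[tr rs]; rewrite (lt_le_trans t0 tr) (le_lt_trans rs sT).
apply: (@quenching_ode_le R alpha M _ t s (u^~ x) (Du^~ x)
  (fun r => lambda * v r x `^ (- p))) => [//|//|//| | | |] r /tsT rT.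
- exact: (u_bnd rT Kx).
- exact: (u_ode rT Kx).
- by have /andP[] := Du_bnd rT Kx.
- have /andP[dv _] := v_bnd rT Kx.
  by rewrite ler_pM2l// powRN_le// ltW.
Qed.

(** From v <= M the absorption coefficient is at least lambda M^(-p) > 0, whatever the point. *)
Let u_lower : exists2 c, 0 < c &
  forall t x, 0 < t < T -> K x -> c * (T - t) <= u t x `^ (1 + alpha).
Proof.
have a0 : 0 < lambda * M `^ (- p) by rewrite mulr_gt0 ?powR_gt0.
have [c c0 H] := quenching_ode_ge alpha_gt0 T_gt0 M_gt0 a0.
exists c => // t x tT Kx.
apply: (H (u^~ x) (Du^~ x) (fun r => lambda * v r x `^ (- p)))
  => [r rT|r rT|r rT|r rT|//].
- by have /andP[] := u_bnd rT Kx.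
- exact: (u_ode rT Kx).
- by have /andP[] := Du_bnd rT Kx.
- have /andP[dv vM] := v_bnd rT Kx.
  by rewrite ler_pM2l// powRN_le ?(lt_le_trans delta_gt0 dv)// ltW.
Qed.

Let m_lbound t : 0 < t < T -> has_lbound (u t @` K).
Proof.
by move=> tT; exists 0 => _ [x Kx <-]; have /andP[/ltW] := u_bnd tT Kx.
Qed.

Let u_rate : same_rate T (fun t => inf (u t @` K))
  (fun t => (T - t) `^ (1 / (1 + alpha))).
Proof.
have [C C_gt0 u_le] := u_upper; have [c c0 cu] := u_lower.
rewrite div1r; set theta := (1 + alpha)^-1.
have theta0 : 0 < theta by rewrite invr_gt0.
(* The factor 2 C collects C (T - t) from the nearly quenched value at a later time s, and C (s - t)
   <= C (T - t) from going back from s to t. *)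
exists ((2 * C) `^ theta)^-1, (c `^ theta)^-1, (T / 2).
have C2 : 0 < 2 * C by rewrite pmulr_rgt0.
split; rewrite ?invr_gt0 ?powR_gt0//.
  by apply/andP; split; move: T_gt0; lra.
move=> t /andP[Tt tT]; have t0 : 0 < t by move: T_gt0; lra.
have tT0 : 0 < t < T by rewrite t0.
have Tt0 : 0 < T - t by rewrite subr_gt0.
rewrite !ler_pdivrMl ?ler_pdivlMl ?powR_gt0 ?mulr_gt0//.
rewrite -!powRM ?mulr_ge0 ?(ltW c0) ?(ltW C_gt0) ?(ltW Tt0)//.
apply/andP; split.
  have [s [x [ts sT Kx usx]]] : exists s x,
      [/\ t < s, s < T, K x & u s x < (C * (T - t)) `^ theta].
    by apply: u_quench => //; rewrite powR_gt0 ?mulr_gt0.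
  apply: (@le_trans _ _ (u t x)).
    by apply: ge_inf; [exact: m_lbound|exists x].
  have /andP[ut0 _] := u_bnd tT0 Kx.
  have sT0 : 0 < s < T by rewrite (lt_trans t0 ts).
  have /andP[us0 _] := u_bnd sT0 Kx.
  apply: powR_le_root; rewrite ?(ltW ut0)//.
  apply: (le_trans (u_le _ _ _ t0 (ltW ts) sT Kx)).
  have : u s x `^ (1 + alpha) <= C * (T - t).
    have := @root_le_powR _ theta (C * (T - t)) (u s x) theta0.
    rewrite /theta invrK; apply; rewrite ?(ltW usx) ?(ltW us0)//.
    exact/ltW/mulr_gt0.
  have : C * (s - t) <= C * (T - t) by rewrite ler_pM2l//; lra.
  lra.
apply: lb_le_inf; first by case: K_neq0 => x Kx; exists (u t x); exists x.
move=> _ [x Kx <-]; have /andP[ut0 _] := u_bnd tT0 Kx.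
apply: root_le_powR => //; [exact: ltW|exact/ltW/mulr_gt0|exact: cu].
Qed.

(** If q >= 1 + alpha, the absorption in the equation of v dominates c / u^(1+alpha), hence c / (eps
    + C (s - r)) at a nearly quenching point, and the logarithmic loss pushes v below delta. *)
Let q_lt : q - alpha < 1.
Proof.
rewrite ltNge; apply/negP => qalpha.
have [C C_gt0 u_le] := u_upper.
have qalpha0 : 0 <= q - (1 + alpha) by lra.
(* The upper bound M on u and v bounds v^(-beta) and u^(-(q - 1 - alpha)) from below; the remaining
   factor of u^(-q) is u^(-(1+alpha)). *)
pose c := mu * M `^ (- beta) * M `^ (- (q - (1 + alpha))).
have c0 : 0 < c by rewrite !mulr_gt0 ?powR_gt0.
pose t := T / 2; have t0 : 0 < t by rewrite divr_gt0.
have CT : 0 < C * (T / 4) by rewrite mulr_gt0// divr_gt0.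
(* This makes (c/C) (ln(C T/4) - ln eps) equal to M + M T, which bounds the initial value of v plus
   all it can gain; v(s, x) <= 0 follows. *)
pose eps := expR (ln (C * (T / 4)) - C / c * (M + M * T)).
have eps0 : 0 < eps by rewrite expR_gt0.
(* Taking s beyond 3T/4 leaves an interval [T/2, s] of length at least T/4, on which the logarithm
   accumulates. *)
have [s [x [ts sT Kx usx]]] : exists s x,
    [/\ 3 * (T / 4) < s, s < T, K x & u s x < eps `^ (1 + alpha)^-1].
  by apply: u_quench; rewrite ?powR_gt0//; move: T_gt0; lra.
have {}ts : t <= s /\ T / 4 <= s - t by rewrite /t; split; lra.
case: ts => ts ts4.
have tsT r : t <= r <= s -> 0 < r < T.
  by move=> /andP[tr rs]; rewrite (lt_le_trans t0 tr) (le_lt_trans rs sT).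
have sT0 : 0 < s < T by apply: tsT; rewrite ts lexx.
have tT0 : 0 < t < T by apply: tsT; rewrite ts lexx.
have useps : u s x `^ (1 + alpha) <= eps.
  have /andP[us0 _] := u_bnd sT0 Kx.
  have a1 : 0 < (1 + alpha)^-1 by rewrite invr_gt0.
  have := @root_le_powR _ _ eps (u s x) a1.
  by rewrite invrK; apply; rewrite ltW.
have := @is_derive_le_log R (v^~ x)
  (fun r => Dv r x - mu * u r x `^ (- q) * v r x `^ (- beta))
  M c C eps t s C_gt0 eps0 ts.
have -> : ln eps = ln (C * (T / 4)) - C / c * (M + M * T) by rewrite /eps expRK.
have : ln (C * (T / 4)) <= ln (eps + C * (s - t)).
  have Cle : C * (T / 4) <= eps + C * (s - t).
    by rewrite ler_wpDl ?(ltW eps0)// ler_pM2l.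
  by rewrite ler_ln ?posrE// (lt_le_trans CT Cle).
move=> lnle H.
have /andP[dvt vtM] := v_bnd tT0 Kx.
have /andP[dvs vsM] := v_bnd sT0 Kx.
have : M * (s - t) <= M * T by rewrite ler_pM2l//; lra.
have : M + M * T <= c / C * (ln (eps + C * (s - t)) -
   (ln (C * (T / 4)) - C / c * (M + M * T))).
  have {1}-> : M + M * T = c / C * (C / c * (M + M * T)).
    by field; rewrite !gt_eqF.
  by rewrite ler_pM2l ?divr_gt0//; lra.
suff : v s x <= v t x + M * (s - t) - c / C * (ln (eps + C * (s - t)) -
   (ln (C * (T / 4)) - C / c * (M + M * T))) by move: delta_gt0; lra.
apply: H => [r /tsT rT|r rts]; first exact: (v_ode rT Kx).
have rT := tsT _ rts.
have /andP[ur0 urM] := u_bnd rT Kx.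
have /andP[dvr vrM] := v_bnd rT Kx.
have vr0 := lt_le_trans delta_gt0 dvr.
apply: lerB; first exact: Dv_bnd.
have /andP[tr rs] := rts; have r0 := lt_le_trans t0 tr.
have Er : u r x `^ (1 + alpha) <= eps + C * (s - r).
  by apply: (le_trans (u_le _ _ _ r0 rs sT Kx)); rewrite lerD2r.
have -> : mu * u r x `^ (- q) * v r x `^ (- beta) = mu * v r x `^ (- beta)
    * (u r x `^ (- (q - (1 + alpha)))) * (u r x `^ (1 + alpha))^-1.
  rewrite -powRN -[RHS]mulrA -powRD ?(gt_eqF ur0) ?implybT//.
  by rewrite mulrAC; congr (_ * _ `^ _); ring.
rewrite ler_pM ?invr_ge0 ?addr_ge0 ?mulr_ge0 ?powR_ge0 ?subr_ge0//
  ?(ltW mu_gt0) ?(ltW eps0) ?(ltW C_gt0)//.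
  rewrite ler_pM ?mulr_ge0 ?powR_ge0 ?(ltW mu_gt0)//.
    by rewrite ler_pM2l// powRN_le// ltW.
  by rewrite powRN_le.
by rewrite lef_pV2 ?posrE ?powR_gt0// (lt_le_trans _ Er)// powR_gt0.
Qed.

Lemma one_component_quenching : q - alpha < 1 /\
  same_rate T (fun t => inf (u t @` K)) (fun t => (T - t) `^ (1 / (1 + alpha))).
Proof. by split; [exact: q_lt|exact: u_rate]. Qed.

End one_component_quenching.

(** * Bounds on compact sets and regularity of smooth curves in C(K) *)

Lemma compact_within_bounded (R : realType) (X : topologicalType)
    (K : set X) (f : X -> R) : compact K -> {within K, continuous f} ->
  exists2 M, 0 < M & forall x, K x -> `|f x| <= M.
Proof.
move=> Kc fc; have /compact_bounded[M [_ bM]] := continuous_compact fc Kc.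
exists (`|M| + 1); first by rewrite ltr_wpDl.
by move=> x Kx; apply: bM; [rewrite ltr_pwDr// ler_norm|exists x].
Qed.

Lemma uniform_cvg_near (R : realType) (X : choiceType) (K : set X)
    (F : set_system R) (f : R -> X -> R) (g : X -> R) (e : R) :
  {uniform K, f s @[s --> F] --> g} -> 0 < e ->
  \forall s \near F, forall x, K x -> `|g x - f s x| < e.
Proof.
move=> fg e0; apply: (fg [set h | forall x, K x -> `|g x - h x| < e]).
apply/uniform_nbhs; exists [set xy | ball xy.1 e xy.2]; split => //.
by rewrite -[e]/(PosNum e0)%:num; exact: entourage_ball.
Qed.

Section curves.
Variables (R : realType) (N : nat) (K : set 'rV[R]_N) (T : R).
Variable (w : R -> 'rV[R]_N -> R).

Lemma is_derive_diff_quotient x t l : 0 < t < T ->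
  diff_quotient w t s x @[s --> within `[0, T[ t^'] --> l ->
  is_derive t 1 (w^~ x) l.
Proof.
move=> /andP[t0 tT] /cvgrPdist_lt cvl.
suff : h^-1 *: ((w^~ x \o shift t) (h *: 1) - w t x) @[h --> 0^'] --> l.
  move=> cl; apply: DeriveDef; first by apply/cvg_ex; exists l.
  exact: cvg_lim cl.
apply/cvgrPdist_lt => e e0.
have /nbhs_ballP[r /= r0 rP] := cvl e e0.
(* Staying within min(t, T - t) of t keeps h + t in [0, T[, so at an interior time the relative
   limit is the ordinary one. *)
have d0 : 0 < Num.min r (Num.min t (T - t)) by rewrite !lt_min r0 t0 subr_gt0.
apply/nbhs_ballP; exists (Num.min r (Num.min t (T - t))) => //= h.
rewrite /ball/= sub0r normrN !lt_min => /andP[hr /andP[ht hT]] hneq0.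
have := rP (h + t); rewrite /ball/= opprD addrCA subrr addr0 normrN => /(_ hr).
have hn : h + t != t by rewrite -subr_eq0 addrK.
move=> /(_ hn); rewrite in_itv/=.
have -> : 0 <= h + t < T.
  by move: ht hT; rewrite !ltr_norml; lra.
move=> /(_ isT); rewrite /diff_quotient addrK.
by rewrite /shift/= /GRing.scale/= mulr1 [_ / h]mulrC.
Qed.

Hypothesis w_smooth : smooth_curve K T w.
Hypothesis K_compact : compact K.

Lemma smooth_curve_continuous t : 0 <= t < T -> {within K, continuous (w t)}.
Proof.
by have [d d0 H] := w_smooth => tT; have [] := H 0%N _ tT; rewrite d0.
Qed.

(** The difference quotients converge uniformly on K to a function that is bounded on the compact K,
    so near t they exceed this bound by at most 1. The constant serves all points x at once. *)
Lemma smooth_curve_lipschitz t : 0 <= t < T ->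
  exists2 L, 0 < L & \forall s \near t, 0 <= s < T ->
    forall x, K x -> `|w s x - w t x| <= L * `|s - t|.
Proof.
have [d d0 dP] := w_smooth => tT.
have [_ qd] := dP 0%N _ tT; have [d1c _] := dP 1%N _ tT.
have [M M0 dM] := compact_within_bounded K_compact d1c.
exists (M + 1); first by rewrite addr_gt0.
have /nbhs_ballP[r /= r0 rP] := uniform_cvg_near qd ltr01.
apply/nbhs_ballP; exists r => //= s rs sT x Kx.
have [->|st] := eqVneq s t; first by rewrite !subrr normr0 mulr0.
have := rP _ rs st; rewrite in_itv/= => /(_ sT x Kx).
rewrite d0 /diff_quotient => q1.
have st0 : 0 < `|s - t| by rewrite normr_gt0 subr_eq0.
rewrite -ler_pdivrMr// -normf_div.
rewrite -[X in `|X|](subKr (d 1%N t x)) (le_trans (ler_normB _ _))//.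
by rewrite lerD ?dM// ltW.
Qed.

Lemma smooth_curve_time_continuous x : K x ->
  {within `[0, T[, continuous (w^~ x)}.
Proof.
move=> Kx; apply/subspace_continuousP => t; rewrite /= in_itv/= => tT.
have [L L0 wL] := smooth_curve_lipschitz tT.
apply/cvgrPdist_le => e e0.
have : \forall s \near t, `|s - t| < e / L.
  apply/nbhs_ballP; exists (e / L); first exact: divr_gt0.
  by move=> s; rewrite /ball/= distrC.
rewrite near_withinE; apply: filterS2 wL => s sL se; rewrite /= in_itv/= => sT.
rewrite distrC (le_trans (sL sT _ Kx))// mulrC -ler_pdivlMr//.
exact: ltW.
Qed.

(** By uniqueness of the derivative, any pointwise limit [l] is the value at x of the derivative in
    C(K). It can thus be applied with [l] the right-hand side of the equation. *)
Lemma smooth_curve_deriv_bounded t : 0 < t < T ->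
  exists2 M, 0 < M & forall x l, K x ->
    diff_quotient w t s x @[s --> within `[0, T[ t^'] --> l -> `|l| <= M.
Proof.
have [d d0 dP] := w_smooth => /andP[t0 tT].
have tT0 : 0 <= t < T by rewrite ltW.
have tT1 : 0 < t < T by rewrite t0.
have [_ qd] := dP 0%N _ tT0; have [d1c _] := dP 1%N _ tT0.
have [M M0 dM] := compact_within_bounded K_compact d1c.
exists M => // x l Kx /(is_derive_diff_quotient tT1) wl.
suff : is_derive t 1 (w^~ x) (d 1%N t x).
  by move=> [_ dw]; have [_ <-] := wl; rewrite dw; exact: dM.
apply: is_derive_diff_quotient => //; apply/cvgrPdist_lt => e e0.
have := uniform_cvg_near qd e0; rewrite d0.
by apply: filterS => s; exact.
Qed.

End curves.

(** * Tools on integrals, cubes, compact closures and lower limits *)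

Lemma ge0_integral_le_cst d (T : measurableType d) (R : realType)
    (mu : {measure set T -> \bar R}) (D B : set T) (f : T -> R) (c : R) :
  measurable B -> D `<=` B -> 0 <= c -> (forall x, D x -> 0 <= f x <= c) ->
  (\int[mu]_(x in D) (f x)%:E <= c%:E * mu B)%E.
Proof.
move=> mB DB c0 fc.
rewrite -(@integral_cst _ _ _ mu B mB) ge0_integralE; last first.
  by move=> x /fc/andP[f0 _]; rewrite lee_fin.
(* Both integrals are suprema over nonnegative simple functions: one lying below [f] on [D] and
   below 0 elsewhere also lies below [c] on [B]. *)
rewrite [leRHS]ge0_integralE; last by move=> x _; rewrite lee_fin.
apply: ub_ereal_sup => _ [h /= hf <-]; apply: ereal_sup_ubound; exists h => //=.
move=> x; apply: (le_trans (hf x)); rewrite /patch.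
case: ifPn => [/set_mem Dx|_].
  by rewrite mem_set ?lee_fin; [have /andP[] := fc _ Dx|exact: DB].
by case: ifPn => _; rewrite ?lee_fin.
Qed.

(** The closed ball of the sup norm when r >= 0, written by coordinates so that it splits as a
    product along [rV_cons]. *)
Definition box (R : realType) (n : nat) (r : R) : set 'rV[R]_n :=
  [set x | forall i, `|x 0 i| <= r].
Arguments box {R} n r.

Lemma measurable_box (R : realType) (n : nat) (r : R) :
  measurable (box n r).
Proof.
rewrite (_ : box n r = \bigcap_(i in [set: 'I_n])
    ((fun x : 'rV[R]_n => x 0 i) @^-1` `[- r, r])); last first.
  apply/seteqP; split => x /= H i; last first.
    by rewrite ler_norml; have := H i I; rewrite /= in_itv.
  by move=> _ /=; rewrite in_itv/= -ler_norml.
apply: fin_bigcap_measurable => // i _; rewrite -[X in measurable X]setTI.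
by apply: measurable_coord => //; exact: measurable_itv.
Qed.

(** Induction on the dimension: [rV_cons] pulls a cube back to an interval times a cube of one
    dimension less, and the measures multiply. *)
Lemma lebesgue_rV_box_fin (R : realType) (n : nat) (r : R) :
  (lebesgue_rV R n (box n r) < +oo)%E.
Proof.
elim: n => [|n IH].
  by rewrite /= diracE; case: (_ \in _) => /=; rewrite ltry.
rewrite /= /lebesgue_step /pushforward.
rewrite (_ : _ @^-1` _ = `[- r, r] `*` box n r); last first.
  apply/seteqP; split => -[a x]; rewrite /box/=.
    move=> H; split.
      by have := H ord0; rewrite rV_cons0/= in_itv/= ler_norml.
    by move=> i; have := H (lift ord0 i); rewrite rV_consS.
  move=> [ar xr] i; have [->|] := eqVneq i ord0.
    by rewrite rV_cons0/= ler_norml; move: ar; rewrite in_itv.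
  by rewrite eq_sym => /unlift_some[j -> _]; rewrite rV_consS/=.
rewrite product_measure1E; [|exact: measurable_itv|exact: measurable_box].
have fI : lebesgue_measure (`[- r, r]%classic : set R) \is a fin_num.
  by rewrite lebesgue_measure_itv/=; case: ifPn.
by apply: lte_mul_pinfty => //; exact: measure_ge0.
Qed.

Lemma bounded_sub_box (R : realType) (n : nat) (A : set 'rV[R]_n) :
  bounded_set A -> exists r : R, A `<=` box n r.
Proof.
move=> [M [_ HM]]; exists (`|M| + 1) => x /HM /= xM i.
have {}xM : `|x| <= `|M| + 1 by apply: xM; rewrite ltr_pwDr// ler_norm.
apply: le_trans xM; rewrite [leRHS]/Num.norm/= mx_normrE.
by apply/bigmax_geP; right => /=; exists (0, i).
Qed.

Lemma bounded_closure_compact (R : realType) (n : nat) (A : set 'rV[R]_n) :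
  bounded_set A -> compact (closure A).
Proof.
move=> [M [_ HM]].
apply: bounded_closed_compact; last exact: closed_closure.
exists (`|M| + 1 + 1); split; first by rewrite num_real.
move=> r Mr x /= clx.
have [y [Ay xy]] := clx _ (nbhsx_ballx x _ ltr01).
rewrite -(subrK y x) (le_trans (ler_normD _ _))// (le_trans _ (ltW Mr))//.
rewrite addrC lerD//; first by apply: HM => //; rewrite ltr_pwDr// ler_norm.
by move: xy; rewrite -ball_normE => /ltW.
Qed.

(** Otherwise eps would bound g from below on the left neighbourhood ]t, T[, hence bound its lower
    limit. *)
Lemma limf_einf_left_lt (R : realType) (g : R -> R) (T t eps : R) :
  limf_einf (fun s => (g s)%:E) T^'- = 0%E -> t < T -> 0 < eps ->
  exists2 s, t < s < T & g s < eps.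
Proof.
move=> g0 tT eps0; apply: contrapT => H.
suff : (eps%:E <= limf_einf (fun s => (g s)%:E) T^'-)%E.
  by rewrite g0 lee_fin leNgt eps0.
rewrite limf_einfE.
apply: (@le_trans _ _ (ereal_inf ((fun s => (g s)%:E) @` [set s | t < s < T]))).
  apply: le_ereal_inf_tmp => _ [s /= sT <-]; rewrite lee_fin leNgt.
  by apply/negP => gs; apply: H; exists s.
apply: ereal_sup_ubound; exists [set s | t < s < T] => //.
by apply: filterS2 (nbhs_left_gt tT) (nbhs_left_lt T) => s /= -> ->.
Qed.

(** * Comparison of a smooth curve with an exponential barrier *)

Lemma smooth_curve_comparison (R : realType) (N : nat) (K : set 'rV[R]_N)
    (T A B : R) (w g : R -> 'rV[R]_N -> R) :
  compact K -> 0 < T -> smooth_curve K T w -> 0 <= A -> 0 <= B ->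
  (forall t x, 0 < t < T -> K x -> is_derive t 1 (w^~ x) (g t x)) ->
  (forall (t M : R), 0 < t < T -> (forall y, K y -> w t y <= M) ->
    forall x, K x -> g t x <= A * M + B) ->
  exists2 M, 0 < M & forall t x, 0 <= t < T -> K x -> w t x <= M.
Proof.
move=> Kc T0 ws A0 B0 wd gle.
have T00 : 0 <= (0 : R) < T by rewrite lexx.
have [M0 M00 wM0] :=
  compact_within_bounded Kc (smooth_curve_continuous ws T00).
(* Since phi >= 1 on [0, T[, the constant B is absorbed: A phi + B <= L phi = phi'. *)
pose L := A + B; have L0 : 0 <= L by rewrite addr_ge0.
pose phi (t : R) : R := (M0 + 1) * expR (L * t).
have phi_le s t : s <= t -> phi s <= phi t.
  by move=> st; rewrite /phi ler_pM2l ?addr_gt0// ler_expR ler_wpM2l.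
have phi0 : phi 0 = M0 + 1 by rewrite /phi mulr0 expR0 mulr1.
have phi_d (t : R) : is_derive t 1 phi (L * phi t).
  have := is_deriveZ (M0 + 1) (is_derive_expRZ L t).
  by rewrite /GRing.scale/= mulrA mulrC.
(* As long as w stays below phi on all of K, w - phi is nonincreasing at each point; it starts at -1
   or less, so the gap 1 persists. *)
have step t : 0 <= t < T ->
    (forall s x, 0 < s < t -> K x -> w s x <= phi s) ->
    forall x, K x -> w t x <= phi t - 1.
  move=> /andP[t0 tT] wphi x Kx.
  have wc : {within `[0, t], continuous (w^~ x)}.
    apply: continuous_subspaceW (smooth_curve_time_continuous ws Kc Kx).
    by move=> s /=; rewrite !in_itv/= => /andP[-> /le_lt_trans]; exact.
  have phic : {within `[0, t], continuous phi}.
    by apply: derivable_within_continuous => s _; have [] := phi_d s.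
  have : w t x - phi t <= w 0 x - phi 0 + 0 * (t - 0).
    apply: (@is_derive_le R (fun s => w s x - phi s)
      (fun s => g s x - L * phi s)) => //.
    - by move=> s; apply: continuousB; [exact: wc|exact: phic].
    - move=> s /andP[s0 st].
      have sT : 0 < s < T by rewrite s0 (lt_trans st).
      exact: (is_deriveB (wd _ _ sT Kx) (phi_d s)).
    - move=> s /andP[s0 st].
      have sT : 0 < s < T by rewrite s0 (lt_trans st).
      have /(gle _ _ sT)/(_ x Kx) : forall y, K y -> w s y <= phi s.
        by move=> y; apply: wphi; rewrite s0.
      have : B * 1 <= B * phi s.
        by rewrite ler_wpM2l// (le_trans _ (phi_le _ _ (ltW s0)))// phi0; lra.
      rewrite /L; lra.
  have := wM0 _ Kx; have := ler_norm (w 0 x); rewrite phi0; lra.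
exists (phi T); first by rewrite /phi mulr_gt0 ?addr_gt0 ?expR_gt0.
move=> t x tT Kx; apply: le_trans (phi_le _ _ (ltW (proj2 (andP tT)))).
rewrite leNgt; apply/negP => bad.
(* At inf S, the first time the barrier could be crossed, the gap is still 1. The uniform Lipschitz
   bound lets w rise by less than 1 within time 1/C, and phi is nondecreasing, so no crossing time
   can be that close to inf S. *)
pose S := [set s | 0 <= s < T /\ exists2 y, K y & phi s < w s y].
have St : S t by split => //; exists x.
have Slb : has_lbound S by exists 0 => s [/andP[]].
have iS0 : 0 <= inf S by apply: lb_le_inf; [exists t|move=> s [/andP[]]].
have iSt : inf S <= t by exact: ge_inf.
have iST : 0 <= inf S < T by rewrite iS0 (le_lt_trans iSt)//; case/andP: tT.
have below s y : 0 < s < inf S -> K y -> w s y <= phi s.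
  move=> /andP[s0 si] Ky; rewrite leNgt; apply/negP => sy.
  suff : inf S <= s by rewrite leNgt si.
  apply: ge_inf => //; split; last by exists y.
  by rewrite (ltW s0) (lt_trans si)// (le_lt_trans iSt)// (proj2 (andP tT)).
have wi := step _ iST below.
have [C C0 wC] := smooth_curve_lipschitz ws Kc iST.
have /nbhs_ballP[r /= r0 rP] := wC.
have rC0 : 0 < Num.min r C^-1 by rewrite lt_min r0 invr_gt0.
have [s [sT [y Ky sy]] si] : exists2 s, S s & s < inf S + Num.min r C^-1.
  by apply: inf_adherent => //; split => //; exists t.
have si0 : inf S <= s by apply: ge_inf => //; split => //; exists y.
have : `|w s y - w (inf S) y| <= C * `|s - inf S|.
  apply: rP => //; rewrite /ball/= distrC ger0_norm ?subr_ge0//.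
  by rewrite ltrBlDl (lt_le_trans si)// lerD2l ge_min lexx.
rewrite [X in C * X]ger0_norm ?subr_ge0//.
have : C * (s - inf S) < 1.
  rewrite -ltr_pdivlMl// mulr1 ltrBlDl (lt_le_trans si)//.
  by rewrite lerD2l ge_min lexx orbT.
have := wi _ Ky; have := phi_le _ _ si0; have := ler_norm (w s y - w (inf S) y).
lra.
Qed.

(** * Bounds on the interior part of the nonlocal term *)

Section nonlocal.
Variables (R : realType) (N : nat) (Omega : set 'rV[R]_N) (J : 'rV[R]_N -> R).
Hypothesis Omega_bounded : bounded_set Omega.
Hypothesis J_kernel : dispersal_kernel J.

Lemma kernel_le0 x : J x <= J 0.
Proof.
apply: (kernel_decreasing J_kernel); rewrite /euclid_norm.
rewrite big1 ?sqrtr0 ?sqrtr_ge0// => i _.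
by rewrite mxE expr0n.
Qed.

(** J is at most J(0) and Omega lies in a cube, so A = J(0) times the measure of the cube works for
    every x. *)
Lemma nonlocal_integral_bound : exists2 A, 0 <= A &
  forall (w : 'rV[R]_N -> R) (M : R) (x : 'rV[R]_N),
  0 <= M -> (forall y, closure Omega y -> 0 <= w y <= M) ->
  0 <= \int[lebesgue_rV R N]_(y in Omega) (J (x - y) * w y) <= A * M.
Proof.
have [r Or] := bounded_sub_box Omega_bounded.
have Bfin : lebesgue_rV R N (box N r) \is a fin_num.
  by rewrite ge0_fin_numE ?lebesgue_rV_box_fin// measure_ge0.
exists (J 0 * fine (lebesgue_rV R N (box N r))).
  by rewrite mulr_ge0 ?(kernel_ge0 J_kernel)// fine_ge0// measure_ge0.
move=> w M x M0 wM.
have J0 := kernel_ge0 J_kernel.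
have Jw y : Omega y -> 0 <= J (x - y) * w y <= J 0 * M.
  move=> /subset_closure/wM/andP[w0 wM'].
  by rewrite mulr_ge0//= ler_pM// kernel_le0.
rewrite Rintegral_ge0/=; last by move=> y /Jw/andP[].
have le := ge0_integral_le_cst (lebesgue_rV R N) (@measurable_box R N r) Or
  (mulr_ge0 (J0 0) M0) Jw.
rewrite mulrAC; have -> : J 0 * M * fine (lebesgue_rV R N (box N r)) =
  fine ((J 0 * M)%:E * lebesgue_rV R N (box N r)) by rewrite fineM.
rewrite /Rintegral fine_le ?fin_numM// ge0_fin_numE.
  apply: (le_lt_trans le); rewrite -ge0_fin_numE ?fin_numM//.
  by rewrite mule_ge0// ?lee_fin ?mulr_ge0.
by apply: integral_ge0 => y /Jw/andP[h _]; rewrite lee_fin.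
Qed.

End nonlocal.

(** * A priori bounds for one equation of the system *)

Section solution_bounds.
Variables (R : realType) (N : nat) (Omega : set 'rV[R]_N) (J : 'rV[R]_N -> R).
Variables (lambda p alpha T : R) (u v : R -> 'rV[R]_N -> R).
Hypothesis Omega_bounded : bounded_set Omega.
Hypothesis Omega_neq0 : Omega !=set0.
Hypothesis J_kernel : dispersal_kernel J.
Hypotheses (lambda_gt0 : 0 < lambda) (p_gt0 : 0 < p) (alpha_gt0 : 0 < alpha).
Hypothesis T_gt0 : 0 < T.
Hypotheses (u_smooth : smooth_curve (closure Omega) T u).
Hypotheses (v_smooth : smooth_curve (closure Omega) T v).
Hypothesis u_gt0 : forall t x, 0 <= t < T -> closure Omega x -> 0 < u t x.
Hypothesis v_gt0 : forall t x, 0 <= t < T -> closure Omega x -> 0 < v t x.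
Hypothesis u_eq : solves_equation Omega J lambda p alpha T u v.

Let closure_compact : compact (closure Omega).
Proof. exact: bounded_closure_compact. Qed.

Let smooth_curve_lbound w t : 0 <= t < T -> smooth_curve (closure Omega) T w ->
  (forall t x, 0 <= t < T -> closure Omega x -> 0 < w t x) ->
  exists2 m, 0 < m & forall x, closure Omega x -> m <= w t x.
Proof.
move=> tT ws w0.
have clO : closure Omega !=set0.
  by case: Omega_neq0 => x Ox; exists x; exact: subset_closure.
have [c /set_mem cO cw] :=
  compact_EVT_min clO closure_compact (smooth_curve_continuous ws tT).
by exists (w t c); [exact: w0|move=> x Ox; apply: cw; exact/mem_set].
Qed.

(* The regularity of the solution makes its nonlocal term bounded, so the
   exterior mass is controlled without translation invariance of the measure. *)
Lemma exterior_mass_bound : exists2 B, 0 <= B & forall x, closure Omega x ->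
  \int[lebesgue_rV R N]_(y in ~` Omega) J (x - y) <= B.
Proof.
have tT : 0 < T / 2 < T by move: T_gt0; lra.
have tT0 : 0 <= T / 2 < T by move: T_gt0; lra.
have [A A0 HA] := nonlocal_integral_bound Omega_bounded J_kernel.
have [D D0 HD] := smooth_curve_deriv_bounded u_smooth closure_compact tT.
have [U U0 HU] := compact_within_bounded closure_compact
  (smooth_curve_continuous u_smooth tT0).
have [mu mu0 Hmu] := smooth_curve_lbound tT0 u_smooth u_gt0.
have [mv mv0 Hmv] := smooth_curve_lbound tT0 v_smooth v_gt0.
(* The equation at time T/2 is solved for the exterior integral: it equals u_t plus the absorption
   plus u, minus a nonnegative interior integral. Here [mu] and [mv] are positive lower bounds of u
   and v at that time. *)
exists (D + lambda * mv `^ (- p) * mu `^ (- alpha) + U).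
  by rewrite !addr_ge0 ?mulr_ge0 ?powR_ge0// ltW.
move=> x Ox; have := HD x _ Ox (u_eq tT0 Ox).
rewrite /nonlocal_diffusion.
have /andP[+ _] :
    0 <= \int[lebesgue_rV R N]_(y in Omega) (J (x - y) * u (T / 2) y) <= A * U.
  apply: HA; first exact: ltW.
  by move=> y Oy; rewrite ltW ?u_gt0//= (le_trans (ler_norm _) (HU _ Oy)).
have := le_trans (ler_norm _) (HU _ Ox).
have : lambda * v (T / 2) x `^ (- p) * u (T / 2) x `^ (- alpha) <=
    lambda * mv `^ (- p) * mu `^ (- alpha).
  rewrite ler_pM ?mulr_ge0 ?powR_ge0 ?(ltW lambda_gt0)//.
    by rewrite ler_pM2l// powRN_le ?Hmv// ltW.
  by rewrite powRN_le ?Hmu// ltW.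
by move=> h1 h2 h3 /ler_normlW; lra.
Qed.

(** The absorption is nonnegative, so u_t is at most the diffusion, which is affine in any upper
    bound of u(t, .); comparison then bounds u up to T. The diffusion is at least -u because both
    integrals are nonnegative. *)
Lemma solution_bound : exists2 M, 0 < M & forall t x, 0 < t < T ->
  closure Omega x ->
  [/\ u t x <= M, - M <= nonlocal_diffusion Omega J (u t) x <= M &
    is_derive t 1 (u^~ x) (nonlocal_diffusion Omega J (u t) x
      - lambda * v t x `^ (- p) * u t x `^ (- alpha))].
Proof.
have tT0 t : 0 < t < T -> 0 <= t < T by move=> /andP[/ltW->].
have ud t x : 0 < t < T -> closure Omega x ->
    is_derive t 1 (u^~ x) (nonlocal_diffusion Omega J (u t) x
      - lambda * v t x `^ (- p) * u t x `^ (- alpha)).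
  move=> tT Ox; apply: (is_derive_diff_quotient tT).
  exact: u_eq (tT0 _ tT) Ox.
have [A A0 HA] := nonlocal_integral_bound Omega_bounded J_kernel.
have [B B0 HB] := exterior_mass_bound.
have ext0 x : 0 <= \int[lebesgue_rV R N]_(y in ~` Omega) J (x - y).
  by apply: Rintegral_ge0 => y _; exact: kernel_ge0.
have nld (t M : R) x : 0 < t < T -> (forall y, closure Omega y -> u t y <= M) ->
    closure Omega x ->
    - u t x <= nonlocal_diffusion Omega J (u t) x <= A * M + B.
  move=> tT uM Ox; have ut0 := u_gt0 (tT0 _ tT) Ox.
  have M0 : 0 <= M by rewrite (le_trans (ltW ut0))// uM.
  have ubnd y : closure Omega y -> 0 <= u t y <= M.
    by move=> Oy; rewrite uM// ltW// u_gt0// tT0.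
  have /andP[] := HA (u t) M x M0 ubnd.
  have := HB _ Ox; have := ext0 x; rewrite /nonlocal_diffusion => h1 h2 h3 h4.
  by apply/andP; split; lra.
have [M M0 HM] : exists2 M, 0 < M & forall t x, 0 <= t < T -> closure Omega x ->
    u t x <= M.
  apply: (smooth_curve_comparison closure_compact T_gt0 u_smooth A0 B0 ud).
  move=> t M tT uM x Ox; have /andP[_ le] := nld _ _ _ tT uM Ox.
  have : 0 <= lambda * v t x `^ (- p) * u t x `^ (- alpha).
    by rewrite !mulr_ge0 ?powR_ge0// ltW.
  lra.
exists (M + (A * M + B)).
  by rewrite ltr_wpDr// addr_ge0// mulr_ge0// ltW.
move=> t x tT Ox; split; last exact: ud.
  have := HM _ _ (tT0 _ tT) Ox; have : 0 <= A * M by rewrite mulr_ge0// ltW.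
  by move: B0; lra.
have := nld t M x tT (fun y => HM t y (tT0 _ tT)) Ox.
have := HM _ _ (tT0 _ tT) Ox; have : 0 <= A * M by rewrite mulr_ge0// ltW.
by move: B0 => ? ? ? /andP[? ?]; apply/andP; split; lra.
Qed.

End solution_bounds.

(** * Application to quenching solutions of the system *)

Lemma quenching_one_component (R : realType) (N : nat)
    (Omega : set 'rV[R]_N) (J : 'rV[R]_N -> R)
    (lambda mu p q alpha beta T delta : R) (u v : R -> 'rV[R]_N -> R) :
  Omega !=set0 -> bounded_set Omega -> dispersal_kernel J ->
  0 < lambda -> 0 < mu -> 0 < p -> 0 < q -> 0 < alpha -> 0 < beta -> 0 < T ->
  smooth_curve (closure Omega) T u -> smooth_curve (closure Omega) T v ->
  (forall t x, 0 <= t < T -> closure Omega x -> 0 < u t x) ->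
  (forall t x, 0 <= t < T -> closure Omega x -> 0 < v t x) ->
  solves_equation Omega J lambda p alpha T u v ->
  solves_equation Omega J mu q beta T v u ->
  limf_einf (fun t => (Num.min (min_closure Omega (u t))
                               (min_closure Omega (v t)))%:E) T^'- = 0%E ->
  0 < delta ->
  (forall t x, 0 <= t < T -> closure Omega x -> delta <= v t x) ->
  q - alpha < 1 /\
    same_rate T (fun t => min_closure Omega (u t))
                (fun t => (T - t) `^ (1 / (1 + alpha))).
Proof.
move=> O0 Ob Jk la0 mu0 p0 q0 al0 be0 T0 us vs u0 v0 ueq veq quench de0 vde.
have [Mu Mu0 HMu] := solution_bound Ob O0 Jk la0 p0 al0 T0 us vs u0 v0 ueq.
have [Mv Mv0 HMv] := solution_bound Ob O0 Jk mu0 q0 be0 T0 vs us v0 u0 veq.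
have clO : closure Omega !=set0.
  by case: O0 => x Ox; exists x; exact: subset_closure.
have tT0 (t : R) : 0 < t < T -> 0 <= t < T by move=> /andP[/ltW->].
apply: (@one_component_quenching R _ (closure Omega) lambda mu p q alpha beta
  T (Mu + Mv) delta u v (fun t => nonlocal_diffusion Omega J (u t))
  (fun t => nonlocal_diffusion Omega J (v t))) => //.
- by rewrite addr_gt0.
- move=> t x tT Ox; have [uM _ _] := HMu t x tT Ox.
  by rewrite u0 ?tT0//=; lra.
- move=> t x tT Ox; have [vM _ _] := HMv t x tT Ox.
  by rewrite vde ?tT0//=; lra.
- move=> t x tT Ox; have [_ /andP[? ?] _] := HMu t x tT Ox.
  by apply/andP; split; lra.
- move=> t x tT Ox; have [_ /andP[? ?] _] := HMv t x tT Ox; lra.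
- by move=> t x tT Ox; have [_ _] := HMu t x tT Ox.
- by move=> t x tT Ox; have [_ _] := HMv t x tT Ox.
- move=> eps t eps0 tT.
  (* The maximum with 0 yields a positive time. The threshold min(eps, delta) forces the small
     minimum to be that of u, since v >= delta. *)
  have mT : Num.max t 0 < T by rewrite gt_max tT T0.
  have me : 0 < Num.min eps delta by rewrite lt_min eps0 de0.
  have [s /andP[] + sT] := limf_einf_left_lt quench mT me.
  rewrite gt_max => /andP[ts s0].
  have sT0 : 0 <= s < T by rewrite ltW.
  have : delta <= min_closure Omega (v s).
    apply: lb_le_inf; first by case: clO => x Ox; exists (v s x); exists x.
    by move=> _ [x Ox <-]; exact: vde.
  rewrite lt_min !gt_min => vs_ge /andP[us_eps us_delta].
  have us_lt : min_closure Omega (u s) < eps.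
    by case/orP: us_eps => // vs_lt; case/orP: us_delta; lra.
  have [|_ [x Ox <-] ux] := inf_lt _ us_lt.
    by case: clO => x Ox; exists (u s x); exists x.
  by exists s, x.
Qed.

Unset Implicit Arguments.

Theorem theorem1p3 (R : realType) (N : nat) (N_gt0 : (0 < N)%N)
    (Omega : set 'rV[R]_N) (J : 'rV[R]_N -> R)
    (lambda mu p q alpha beta : R) (u0 v0 : 'rV[R]_N -> R)
    (T : R) (u v : R -> 'rV[R]_N -> R)
    (Omega_domain : smooth_bounded_domain Omega) (J_kernel : dispersal_kernel J)
    (lambda_gt0 : 0 < lambda) (mu_gt0 : 0 < mu) (p_gt0 : 0 < p) (q_gt0 : 0 < q)
    (alpha_gt0 : 0 < alpha) (beta_gt0 : 0 < beta)
    (u0_init : initial_datum Omega u0) (v0_init : initial_datum Omega v0)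
    (T_gt0 : 0 < T)
    (uv_quench :
      quenching_solution Omega J lambda mu p q alpha beta u0 v0 T u v) :
  ((exists2 delta : R, 0 < delta &
      forall t x, 0 <= t < T -> closure Omega x -> delta <= v t x) ->
    q - alpha < 1 /\
    same_rate T (fun t => min_closure Omega (u t))
                (fun t => (T - t) `^ (1 / (1 + alpha)))) /\
  ((exists2 delta : R, 0 < delta &
      forall t x, 0 <= t < T -> closure Omega x -> delta <= u t x) ->
    p - beta < 1 /\
    same_rate T (fun t => min_closure Omega (v t))
                (fun t => (T - t) `^ (1 / (1 + beta)))).
Proof.
have [dom_neq0 _ dom_bounded _ _] := Omega_domain.
have [[uv_sol _] quench] := uv_quench.
have [us vs u_gt0 v_gt0 u_eq v_eq _ _] := uv_sol.
split=> -[delta delta_gt0 bound].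
  by apply: (@quenching_one_component R N Omega J lambda mu p q alpha beta
    T delta u v).
(* The system is symmetric under exchanging (u, lambda, p, alpha) with (v, mu, q, beta), and so is
   the quenching condition up to commuting the minimum. *)
apply: (@quenching_one_component R N Omega J mu lambda q p beta alpha
  T delta v u) => //.
by under eq_fun do rewrite minC.
Qed.
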